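(* Consider Problem (P) below and suppose the Sparsity Assumption and the Compactness/Generation Assumption (parts (a) and (b)) hold. Fix $k\in\mathbb N$. Then the sequence $(q^k_d)_{d\in\mathbb N}$ is monotone non-decreasing and $q^k_d\to f^*$ as $d\to\infty$.
   Context: Problem (P): $f^*=\min\{f(\mathbf x):\mathbf x\in\mathbf K\}$ with $\mathbf K=\{\mathbf x\in\mathbb R^n:0\le g_j(\mathbf x)\le 1,\ j=1,\ldots,m\}$, $f,g_j\in\mathbb R[\mathbf x]$. $\mathbb R[\mathbf x;I]$ is the ring of polynomials in $\{x_i:i\in I\}$, $\mathbb R[\mathbf x;I]_t$ those of degree $\le t$, and $\Sigma[\mathbf x;I]_k$ the sums of squares of polynomials in $\mathbb R[\mathbf x;I]_k$. Sparsity Assumption: there are $p\in\mathbb N$ and sets $I_\ell\subseteq\{1,\ldots,n\}$, $J_\ell\subseteq\{1,\ldots,m\}$ with $f=\sum_\ell f^\ell$ for some $f^\ell\in\mathbb R[\mathbf x;I_\ell]$, $g_j\in\mathbb R[\mathbf x;I_\ell]$ for $j\in J_\ell$, $\bigcup_\ell I_\ell=\{1,\ldots,n\}$, $\bigcup_\ell J_\ell=\{1,\ldots,m\}$, and for every $\ell\le p-1$ some $s\le\ell$ with $I_{\ell+1}\cap\bigcup_{r\le\ell}I_r\subseteq I_s$. Compactness/Generation Assumption: (a) for each $\ell$ the set $\mathbf K_\ell=\{\mathbf z\in\mathbb R^{|I_\ell|}:0\le g_j(\mathbf z)\le1,\ j\in J_\ell\}$ is compact and $1,(g_j)_{j\in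 J_\ell}$ generate $\mathbb R[\mathbf x;I_\ell]$ as an $\mathbb R$-algebra; (b) for each $\ell$ there exist $M_\ell>0$ and $j\in J_\ell$ with $g_j=1-M_\ell^{-1}\sum_{i\in I_\ell}x_i^2$. $h_{\alpha\beta}=\prod_j g_j^{\alpha_j}(1-g_j)^{\beta_j}$ for $\alpha,\beta\in\mathbb N_0^m$; $N^\ell_d=\{(\alpha,\beta)\in\mathbb N_0^m\times\mathbb N_0^m:\mathrm{supp}(\alpha)\cup\mathrm{supp}(\beta)\subseteq J_\ell,\ \sum_j(\alpha_j+\beta_j)\le d\}$; $d_{\max}=\max\{\deg f,2k,d\max_j\deg g_j\}$. $q^k_d=\sup\{t: f-t=\sum_{\ell=1}^p f^\ell,\ f^\ell\in\mathbb R[\mathbf x;I_\ell]_{d_{\max}},\ f^\ell-\sum_{(\alpha,\beta)\in N^\ell_d}\lambda^\ell_{\alpha\beta}h_{\alpha\beta}\in\Sigma[\mathbf x;I_\ell]_k,\ \lambda^\ell_{\alpha\beta}\ge0,\ t\in\mathbb R\}$, where the $f^\ell$, $\lambda^\ell$, $t$ are decision variables. *)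

(* Defs.v *)
From HB Require Import structures.
From mathcomp Require Import all_boot all_order all_algebra.
From mathcomp Require Import mpoly.
From mathcomp Require Import all_classical all_reals all_analysis.

Set Implicit Arguments.
Unset Strict Implicit.
Unset Printing Implicit Defensive.

Import Order.TTheory GRing.Theory Num.Theory numFieldNormedType.Exports.
Local Open Scope ring_scope.

Section SparseBSOS.
Variable R : realType.

Definition mev (n : nat) (x : 'rV[R]_n) (q : {mpoly R[n]}) : R :=
  meval (fun i => x ord0 i) q.

(* total degree of a polynomial (deg 0 = 0 by convention) *)
Definition mdegree (n : nat) (q : {mpoly R[n]}) : nat := (msize q).-1.

Definition in_vars (n : nat) (I : {set 'I_n}) (q : {mpoly R[n]}) : Prop :=
  forall mo : 'X_{1..n}, mo \in msupp q -> forall i : 'I_n, i \notin I -> mo i = 0%N.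

Definition poly_in (n : nat) (I : {set 'I_n}) (t : nat) (q : {mpoly R[n]}) : Prop :=
  in_vars I q /\ (msize q <= t.+1)%N.

Definition sos_in (n : nat) (I : {set 'I_n}) (k : nat) (q : {mpoly R[n]}) : Prop :=
  exists s : seq {mpoly R[n]},
    (forall h, h \in s -> poly_in I k h) /\ q = \sum_(h <- s) h ^+ 2.

Definition Kset (n m : nat) (g : 'I_m -> {mpoly R[n]}) : set 'rV[R]_n :=
  [set x : 'rV[R]_n | forall j : 'I_m, 0 <= mev x (g j) <= 1].

(* f^* = inf { f(x) : x in K }  (in the extended reals; +oo if K is empty) *)
Definition fstar (n m : nat) (f : {mpoly R[n]}) (g : 'I_m -> {mpoly R[n]}) : \bar R :=
  ereal_inf [set (mev x f)%:E | x in Kset g].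

(* K_l, realised inside R^n as the points supported on I_l (a copy of R^{|I_l|}) *)
Definition Kloc (n m : nat) (g : 'I_m -> {mpoly R[n]}) (I : {set 'I_n}) (J : {set 'I_m})
  : set 'rV[R]_n :=
  [set x : 'rV[R]_n | (forall i : 'I_n, i \notin I -> x ord0 i = 0) /\
           (forall j : 'I_m, j \in J -> 0 <= mev x (g j) <= 1)].

Definition sparsity (n m p : nat) (f : {mpoly R[n]}) (g : 'I_m -> {mpoly R[n]})
  (I : 'I_p -> {set 'I_n}) (J : 'I_p -> {set 'I_m}) : Prop :=
  [/\ exists fl : 'I_p -> {mpoly R[n]},
        f = \sum_(l < p) fl l /\ forall l, in_vars (I l) (fl l),
      forall (l : 'I_p) (j : 'I_m), j \in J l -> in_vars (I l) (g j),
      forall i : 'I_n, exists l : 'I_p, i \in I l,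
      forall j : 'I_m, exists l : 'I_p, j \in J l &
      forall l l' : 'I_p, val l' = (val l).+1 ->
        exists s : 'I_p, (s <= l)%N /\
          forall i : 'I_n, i \in I l' -> (exists r : 'I_p, (r <= l)%N /\ i \in I r) ->
            i \in I s].

Definition generates (n m : nat) (g : 'I_m -> {mpoly R[n]}) (I : {set 'I_n})
  (J : {set 'I_m}) : Prop :=
  forall q : {mpoly R[n]}, in_vars I q ->
    exists P : {mpoly R[m]}, in_vars J P /\ q = P \mPo [tuple g j | j < m].

Definition compact_gen (n m p : nat) (g : 'I_m -> {mpoly R[n]})
  (I : 'I_p -> {set 'I_n}) (J : 'I_p -> {set 'I_m}) : Prop :=
  forall l : 'I_p,
    [/\ compact (Kloc g (I l) (J l)),
        generates g (I l) (J l) &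
        exists M : R, 0 < M /\ exists2 j : 'I_m, j \in J l &
          g j = 1 - M^-1 *: \sum_(i in I l) 'X_i ^+ 2].

Definition hab (n m : nat) (g : 'I_m -> {mpoly R[n]}) (a b : 'I_m -> nat) : {mpoly R[n]} :=
  \prod_(j < m) (g j ^+ a j * (1 - g j) ^+ b j).

(* (alpha, beta) in N^l_d.  Pairs are encoded with entries in 'I_d.+1, which is
   no restriction since sum_j (alpha_j + beta_j) <= d forces alpha_j, beta_j <= d. *)
Definition inN (m d : nat) (J : {set 'I_m}) (a b : {ffun 'I_m -> 'I_d.+1}) : bool :=
  [forall j, (j \notin J) ==> ((a j == 0%N :> nat) && (b j == 0%N :> nat))] &&
  (\sum_(j < m) (a j + b j) <= d)%N.

Definition dmax (n m : nat) (f : {mpoly R[n]}) (g : 'I_m -> {mpoly R[n]}) (k d : nat) : nat :=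
  maxn (mdegree f) (maxn (2 * k) (d * \max_(j < m) mdegree (g j))).

Definition qfeas (n m p : nat) (f : {mpoly R[n]}) (g : 'I_m -> {mpoly R[n]})
  (I : 'I_p -> {set 'I_n}) (J : 'I_p -> {set 'I_m}) (k d : nat) (t : R) : Prop :=
  exists (fl : 'I_p -> {mpoly R[n]})
         (lam : 'I_p -> {ffun 'I_m -> 'I_d.+1} -> {ffun 'I_m -> 'I_d.+1} -> R),
    f - t%:MP = \sum_(l < p) fl l /\
    forall l : 'I_p,
      [/\ poly_in (I l) (dmax f g k d) (fl l),
          (forall a b, inN (J l) a b -> 0 <= lam l a b) &
          sos_in (I l) k
            (fl l - \sum_(a : {ffun 'I_m -> 'I_d.+1})
                      \sum_(b : {ffun 'I_m -> 'I_d.+1} | inN (J l) a b)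
                        lam l a b *: hab g (fun j => nat_of_ord (a j))
                                           (fun j => nat_of_ord (b j)))].

Definition qkd (n m p : nat) (f : {mpoly R[n]}) (g : 'I_m -> {mpoly R[n]})
  (I : 'I_p -> {set 'I_n}) (J : 'I_p -> {set 'I_m}) (k d : nat) : \bar R :=
  ereal_sup [set t%:E | t in qfeas f g I J k d].

End SparseBSOS.

(* Main.v *)
(** Let [t < f^*]. By the running intersection property, [f - t] can be written as a
    sum of block polynomials [f_l] that are positive on the whole of [K_l]: the
    blocks are split off one at a time, moving between a block and the rest a
    polynomial in the shared variables that separates the partial minima of both
    sides. Each such [f_l] is a polynomial [P] in the generators [g_j], positive at
    the points of the cube [0, 1]^J of the form [g(x)]. These points are cut out by
    polynomial equations, so a large multiple of the squares of the equations makes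
    [P] positive on the cube, and the expansion of a positive polynomial in the
    Bernstein basis of high order has nonnegative coefficients. Substituting [g]
    gives [f_l] as a nonnegative combination of the [h_ab]; the sum of squares may
    be taken to be [0]. *)

Require Import Defs.
From HB Require Import structures.
From mathcomp Require Import all_boot all_order all_algebra.
From mathcomp Require Import mpoly.
From mathcomp Require Import all_classical all_reals all_analysis.
From mathcomp Require Import ring lra zify.

Set Implicit Arguments.
Unset Strict Implicit.
Unset Printing Implicit Defensive.

Import Order.TTheory GRing.Theory Num.Theory numFieldNormedType.Exports.
Local Open Scope classical_set_scope.
Local Open Scope ring_scope.

(** * Polynomials in a subset of the variables: closure, evaluation, degree bounds, substitution *)

Section PolynomialsInVariables.
Variables (R : realType) (n : nat).
Implicit Types (I W : {set 'I_n}) (p q : {mpoly R[n]}) (x y : 'rV[R]_n).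

Lemma in_varsC I c : in_vars I (c%:MP : {mpoly R[n]}).
Proof.
move=> mo; rewrite msuppC; case: ifP => // _; rewrite inE => /eqP -> i _.
by rewrite mnm0E.
Qed.

Lemma in_vars0 I : in_vars I (0 : {mpoly R[n]}).
Proof. by move=> mo; rewrite msupp0. Qed.

Lemma in_vars1 I : in_vars I (1 : {mpoly R[n]}).
Proof. exact: in_varsC. Qed.

Lemma in_varsD I p q : in_vars I p -> in_vars I q -> in_vars I (p + q).
Proof.
move=> hp hq mo /msuppD_le; rewrite mem_cat => /orP[]; [exact: hp|exact: hq].
Qed.

Lemma in_varsN I p : in_vars I p -> in_vars I (- p).
Proof. by move=> hp mo; rewrite (perm_mem (msuppN p)); exact: hp. Qed.

Lemma in_varsB I p q : in_vars I p -> in_vars I q -> in_vars I (p - q).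
Proof. by move=> hp hq; apply: in_varsD => //; exact: in_varsN. Qed.

Lemma in_varsM I p q : in_vars I p -> in_vars I q -> in_vars I (p * q).
Proof.
move=> hp hq mo /msuppM_le /allpairsP[[m1 m2] /= [h1 h2 ->]] i iI.
by rewrite mnmDE (hp _ h1 _ iI) (hq _ h2 _ iI).
Qed.

Lemma in_varsZ I c p : in_vars I p -> in_vars I (c *: p).
Proof. by move=> hp mo /msuppZ_le; exact: hp. Qed.

Lemma in_varsX I i : i \in I -> in_vars I ('X_i : {mpoly R[n]}).
Proof.
move=> iI mo; rewrite msuppX inE => /eqP -> j jI.
by rewrite mnm1E; case: eqP => // ij; move: jI; rewrite -ij iI.
Qed.

Lemma in_vars_sum I T (r : seq T) (P : pred T) (F : T -> {mpoly R[n]}) :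
  (forall t, P t -> in_vars I (F t)) -> in_vars I (\sum_(t <- r | P t) F t).
Proof.
move=> hF; elim/big_ind : _ => //; first exact: in_vars0.
by move=> *; exact: in_varsD.
Qed.

Lemma in_vars_prod I T (r : seq T) (P : pred T) (F : T -> {mpoly R[n]}) :
  (forall t, P t -> in_vars I (F t)) -> in_vars I (\prod_(t <- r | P t) F t).
Proof.
move=> hF; elim/big_ind : _ => //; first exact: in_vars1.
by move=> *; exact: in_varsM.
Qed.

Lemma in_varsXn I p k : in_vars I p -> in_vars I (p ^+ k).
Proof.
move=> hp; elim: k => [|k IH]; first exact: in_vars1.
by rewrite exprS; exact: in_varsM.
Qed.

Lemma in_varsS I W p : W \subset I -> in_vars W p -> in_vars I p.
Proof.
move=> WI hp mo hmo i iI; apply: hp hmo _ _.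
by apply: contra iI; exact: (fintype.subsetP WI).
Qed.

Lemma mevE x p : mev x p = \sum_(mo <- msupp p) p@_mo * \prod_i x ord0 i ^+ mo i.
Proof. exact: mevalE. Qed.

Lemma mevD x p q : mev x (p + q) = mev x p + mev x q.
Proof. exact: mevalD. Qed.

Lemma mevB x p q : mev x (p - q) = mev x p - mev x q.
Proof. exact: mevalB. Qed.

Lemma mevM x p q : mev x (p * q) = mev x p * mev x q.
Proof. exact: mevalM. Qed.

Lemma mevZ x c p : mev x (c *: p) = c * mev x p.
Proof. exact: mevalZ. Qed.

Lemma mevC x c : mev x (c%:MP : {mpoly R[n]}) = c.
Proof. exact: mevalC. Qed.

Lemma mev0 x : mev x (0 : {mpoly R[n]}) = 0.
Proof. exact: meval0. Qed.

Lemma mev1 x : mev x (1 : {mpoly R[n]}) = 1.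
Proof. exact: meval1. Qed.

Lemma mevX x i : mev x ('X_i : {mpoly R[n]}) = x ord0 i.
Proof. exact: mevalXU. Qed.

Lemma mevXn x p k : mev x (p ^+ k) = mev x p ^+ k.
Proof. exact: rmorphXn. Qed.

Lemma mev_sum x T (r : seq T) (P : pred T) (F : T -> {mpoly R[n]}) :
  mev x (\sum_(t <- r | P t) F t) = \sum_(t <- r | P t) mev x (F t).
Proof. exact: raddf_sum. Qed.

Lemma mev_prod x T (r : seq T) (P : pred T) (F : T -> {mpoly R[n]}) :
  mev x (\prod_(t <- r | P t) F t) = \prod_(t <- r | P t) mev x (F t).
Proof. exact: rmorph_prod. Qed.

Lemma mev_in_vars I p x y : in_vars I p ->
  (forall i, i \in I -> x ord0 i = y ord0 i) -> mev x p = mev y p.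
Proof.
move=> hp xy; rewrite !mevE; apply: eq_big_seq => mo hmo; congr (_ * _).
apply: eq_bigr => i _; have [iI|iI] := boolP (i \in I); first by rewrite xy.
by rewrite (hp _ hmo _ iI).
Qed.

Lemma mev_continuous p : continuous (fun x => mev x p).
Proof.
rewrite (_ : (fun x => _) =
  (fun x => \sum_(mo <- msupp p) p@_mo * \prod_i x ord0 i ^+ mo i)); last first.
  by apply/funext => z; rewrite mevE.
have contX (i : 'I_n) (k : nat) : continuous (fun x : 'rV[R]_n => x ord0 i ^+ k : R).
  elim: k => [|k IH]; first exact: cst_continuous.
  rewrite (_ : (fun x => _) = (fun x : 'rV[R]_n => x ord0 i * x ord0 i ^+ k)).
    by move=> x; exact: (continuousM (@coord_continuous _ _ _ _ _ x) (IH x)).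
  by apply/funext => x; rewrite exprS.
have contM (mo : 'X_{1..n}) :
    continuous (fun x : 'rV[R]_n => \prod_i x ord0 i ^+ mo i : R).
  by apply: (@continuous_big R _ *%R 1 xpredT (@mul_continuous R)) => i _.
have contD : continuous (fun z : R * R => z.1 + z.2).
  by move=> z; apply: cvgD; [exact: cvg_fst|exact: cvg_snd].
apply: (@continuous_big R _ +%R 0 xpredT contD) => mo _ x.
by apply: (continuousM (@cst_continuous _ _ p@_mo x) (contM mo x)).
Qed.

Lemma msizeD_bound t p q :
  (msize p <= t)%N -> (msize q <= t)%N -> (msize (p + q) <= t)%N.
Proof.
by move=> hp hq; rewrite (leq_trans (msizeD_le _ _))// geq_max hp.
Qed.

Lemma msizeM_bound s t p q :
  (msize p <= s.+1)%N -> (msize q <= t.+1)%N -> (msize (p * q) <= (s + t).+1)%N.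
Proof.
move=> hp hq; have [->|p0] := eqVneq p 0; first by rewrite mul0r msize0.
have [->|q0] := eqVneq q 0; first by rewrite mulr0 msize0.
rewrite msizeM//; apply: (@leq_trans (s.+1 + t.+1).-1).
  by rewrite -!subn1 leq_sub2r// leq_add.
by rewrite addSn addnS.
Qed.

Lemma msizeX_bound s p k :
  (msize p <= s.+1)%N -> (msize (p ^+ k) <= (k * s).+1)%N.
Proof.
move=> hp; elim: k => [|k IH]; first by rewrite expr0 msize1.
by rewrite exprS mulSn; exact: msizeM_bound.
Qed.

End PolynomialsInVariables.

Lemma in_vars_comp (R : realType) (n m : nat) (I : {set 'I_n})
    (lq : m.-tuple {mpoly R[n]}) (q : {mpoly R[m]}) :
  (forall j, in_vars I (tnth lq j)) -> in_vars I (q \mPo lq).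
Proof.
move=> h; rewrite comp_mpolyE; apply: in_vars_sum => mo _.
apply: in_varsZ; apply: in_vars_prod => j _; exact: in_varsXn.
Qed.

Lemma comp_mpoly_in_vars (R : realType) (n m : nat) (I : {set 'I_n})
    (lq lq' : n.-tuple {mpoly R[m]}) (q : {mpoly R[n]}) :
  in_vars I q -> (forall i, i \in I -> tnth lq i = tnth lq' i) ->
  q \mPo lq = q \mPo lq'.
Proof.
move=> hq h; rewrite !comp_mpolyE; apply: eq_big_seq => mo hmo.
congr (_ *: _); apply: eq_bigr => i _.
by have [iI|iI] := boolP (i \in I); [rewrite h|rewrite (hq _ hmo _ iI)].
Qed.

Lemma comp_mpolyA (R : realType) (n m k : nat) (q : {mpoly R[n]})
    (lp : n.-tuple {mpoly R[m]}) (lq : m.-tuple {mpoly R[k]}) :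
  (q \mPo lp) \mPo lq = q \mPo [tuple tnth lp i \mPo lq | i < n].
Proof.
rewrite (comp_mpolyE q lp) raddf_sum [RHS]comp_mpolyE; apply: eq_bigr => mo _.
rewrite /= comp_mpolyZ rmorph_prod; congr (_ *: _); apply: eq_bigr => i _.
by rewrite rmorphXn tnth_mktuple.
Qed.

(** * The cone spanned by the products [h_ab] supported on one block *)

Section Kcone.
Variables (R : realType) (n m : nat) (g : 'I_m -> {mpoly R[n]}) (J : {set 'I_m}).
Implicit Types (p q : {mpoly R[n]}).

(** The multipliers have the same encoding as in [qfeas], so that a block constraint reads: [fl l]
    minus a sum of squares lies in this cone. *)
Definition kcone (d : nat) q : Prop :=
  exists lam : {ffun 'I_m -> 'I_d.+1} -> {ffun 'I_m -> 'I_d.+1} -> R,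
    (forall a b, inN J a b -> 0 <= lam a b) /\
    q = \sum_(a : {ffun 'I_m -> 'I_d.+1})
          \sum_(b : {ffun 'I_m -> 'I_d.+1} | inN J a b)
            lam a b *: hab g (fun j => nat_of_ord (a j)) (fun j => nat_of_ord (b j)).

Lemma kcone0 d : kcone d 0.
Proof.
exists (fun _ _ => 0); split => //; rewrite big1 // => a _.
by rewrite big1 // => b _; rewrite scale0r.
Qed.

Lemma kconeD d p q : kcone d p -> kcone d q -> kcone d (p + q).
Proof.
move=> [l1 [l1p ->]] [l2 [l2p ->]]; exists (fun a b => l1 a b + l2 a b).
split; first by move=> a b ab; rewrite addr_ge0 ?l1p ?l2p.
rewrite -big_split; apply: eq_bigr => a _; rewrite -big_split.
by apply: eq_bigr => b _; rewrite scalerDl.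
Qed.

Lemma kconeZ d c q : 0 <= c -> kcone d q -> kcone d (c *: q).
Proof.
move=> c0 [l [lp ->]]; exists (fun a b => c * l a b); split.
  by move=> a b ab; rewrite mulr_ge0 ?lp.
rewrite scaler_sumr; apply: eq_bigr => a _; rewrite scaler_sumr.
by apply: eq_bigr => b _; rewrite scalerA.
Qed.

Lemma kcone_sum d T (r : seq T) (P : pred T) (F : T -> {mpoly R[n]}) :
  (forall t, P t -> kcone d (F t)) -> kcone d (\sum_(t <- r | P t) F t).
Proof.
move=> hF; elim/big_ind : _ => //; first exact: kcone0.
by move=> *; exact: kconeD.
Qed.

Lemma eq_hab (a a' b b' : 'I_m -> nat) : a =1 a' -> b =1 b' -> hab g a b = hab g a' b'.
Proof. by move=> aa bb; apply: eq_bigr => j _; rewrite aa bb. Qed.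

(** Each exponent is at most the total, hence fits in ['I_d.+1]; the multiplier is the indicator of
    the one pair obtained. *)
Lemma kcone_hab d (a b : 'I_m -> nat) : (forall j, j \notin J -> a j = 0%N /\ b j = 0%N) ->
  (\sum_j (a j + b j) <= d)%N -> kcone d (hab g a b).
Proof.
move=> abJ abd.
have abj j : (a j + b j <= d)%N.
  by apply: leq_trans abd; rewrite (bigD1 j) //= leq_addr.
have aj j : (a j < d.+1)%N by rewrite ltnS (leq_trans _ (abj j)) // leq_addr.
have bj j : (b j < d.+1)%N by rewrite ltnS (leq_trans _ (abj j)) // leq_addl.
pose A := [ffun j => Ordinal (aj j)]; pose B := [ffun j => Ordinal (bj j)].
have AE j : A j = a j :> nat by rewrite ffunE.
have BE j : B j = b j :> nat by rewrite ffunE.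
have AB : inN J A B.
  apply/andP; split.
    apply/forallP => j; apply/implyP => /abJ[a0 b0].
    by rewrite AE BE a0 b0 !eqxx.
  by under eq_bigr do rewrite AE BE.
exists (fun x y => ((x == A) && (y == B))%:R); split => [x y _|]; first exact: ler0n.
rewrite (bigD1 A) //= [X in _ + X]big1 ?addr0; last first.
  by move=> x /negPf xA; rewrite big1 // => y _; rewrite xA scale0r.
rewrite (bigD1 B) //= [X in _ + X]big1 ?addr0; last first.
  by move=> y /andP[_ /negPf yB]; rewrite yB andbF scale0r.
by rewrite !eqxx scale1r; apply: eq_hab => j; rewrite ?AE ?BE.
Qed.

(** The index type depends on [d], so every term is re-encoded through [kcone_hab]. *)
Lemma kcone_mono d d' q : (d <= d')%N -> kcone d q -> kcone d' q.
Proof.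
move=> dd [l [lp ->]]; apply: kcone_sum => a _; apply: kcone_sum => b ab.
apply: kconeZ; first exact: lp.
case/andP: ab => /forallP abJ abd; apply: kcone_hab.
  by move=> j jJ; have /implyP/(_ jJ)/andP[/eqP-> /eqP->] := abJ j.
exact: leq_trans dd.
Qed.

(** Neither [g j] nor [1 - g j] exceeds the maximal degree, and the exponents add up to at most [d].
    This settles the degree constraint of [qfeas] when the sum of squares is [0]. *)
Lemma kcone_msize d q : kcone d q ->
  (msize q <= (d * \max_(j < m) mdegree (g j)).+1)%N.
Proof.
set G := \max_(j < m) _; move=> [l [lp ->]].
have h0 : (msize (0 : {mpoly R[n]}) <= (d * G).+1)%N by rewrite msize0.
elim/big_ind : _ => //; first by move=> *; exact: msizeD_bound.
move=> a _; elim/big_ind : _ => //; first by move=> *; exact: msizeD_bound.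
move=> b /andP[_ abd]; apply: leq_trans (msizeZ_le _ _) _.
have gG j : (msize (g j) <= G.+1)%N.
  rewrite (leq_trans (leqSpred _)) // ltnS.
  exact: (leq_bigmax_cond (F := fun j => mdegree (g j))).
apply: (@leq_trans ((\sum_j (a j + b j)) * G).+1); last by rewrite ltnS leq_mul2r abd orbT.
rewrite /hab big_distrl /=.
elim/big_ind2 : _ => [|p s q' t|j _]; first by rewrite msize1.
  exact: msizeM_bound.
rewrite mulnDl; apply: msizeM_bound; apply: msizeX_bound => //.
apply: msizeD_bound; first by rewrite msize1.
by rewrite mmeasureN.
Qed.

Lemma kcone_ge0 d q (x : 'rV[R]_n) : (forall j, j \in J -> 0 <= mev x (g j) <= 1) ->
  kcone d q -> 0 <= mev x q.
Proof.
move=> xK [l [lp ->]]; rewrite mev_sum sumr_ge0 // => a _.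
rewrite mev_sum sumr_ge0 // => b ab; rewrite mevZ mulr_ge0 ?lp //.
rewrite mev_prod prodr_ge0 // => j _; rewrite mevM !mevXn mevB mev1.
have [jJ|jJ] := boolP (j \in J).
  by case/andP: (xK _ jJ) => *; rewrite mulr_ge0 ?exprn_ge0 ?subr_ge0.
case/andP: ab => /forallP/(_ j)/implyP/(_ jJ)/andP[/eqP-> /eqP->] _.
by rewrite !expr0 mulr1 ler01.
Qed.

End Kcone.

(** * Bernstein expansion of polynomials positive on the cube *)

Section Bernstein.
Variable R : realType.

(** The coefficient of [y ^ a] at the [i]-th element [C(D, i) y ^ i (1 - y) ^ (D - i)] of the
    Bernstein basis of order [D]. *)
Definition binratio (D i a : nat) : R := 'C(i, a)%:R / 'C(D, a)%:R.

(** Both sides count the nested subsets of sizes [a] and [i] in a set of size [D]. *)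
Lemma mul_bin_sub D i a : (a <= i)%N -> (i <= D)%N ->
  ('C(D, i) * 'C(i, a) = 'C(D, a) * 'C(D - a, i - a))%N.
Proof.
move=> ai iD; have aD := leq_trans ai iD.
have h : (0 < a`! * (i - a)`! * (D - i)`!)%N by rewrite !muln_gt0 !fact_gt0.
apply/eqP; rewrite -(eqn_pmul2r h); apply/eqP.
have E1 := bin_fact iD; have E2 := bin_fact ai; have E3 := bin_fact aD.
have E4 := bin_fact (leq_sub2r a iD); rewrite subnBA // subnK // in E4.
transitivity ('C(D, i) * ('C(i, a) * (a`! * (i - a)`!) * (D - i)`!))%N.
  by rewrite !mulnA.
rewrite E2 E1 -E3 -E4 !mulnA; congr (_ * _)%N.
by rewrite -!mulnA; congr (_ * _)%N; rewrite mulnCA.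
Qed.

(** Degree elevation: multiply [y ^ a] by [((1 - y) + y) ^ (D - a) = 1] and expand. *)
Lemma exprn_bernstein n (y : {mpoly R[n]}) D a : (a <= D)%N ->
  y ^+ a = \sum_(i < D.+1)
    (binratio D i a * 'C(D, i)%:R) *: (y ^+ i * (1 - y) ^+ (D - i)).
Proof.
move=> aD.
have Ca : 'C(D, a)%:R != 0 :> R by rewrite pnatr_eq0 -lt0n bin_gt0.
rewrite -(big_mkord xpredT (fun i => (binratio D i a * 'C(D, i)%:R) *:
  (y ^+ i * (1 - y) ^+ (D - i)))) (big_cat_nat _ (n := a)) //=; last exact: leqW.
rewrite big_nat big1 ?add0r; last first.
  by move=> i /andP[_ ia]; rewrite /binratio bin_small // !mul0r scale0r.
rewrite -{2}(add0n a) big_addn subSn // big_mkord.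
transitivity (y ^+ a * ((1 - y) + y) ^+ (D - a)).
  by rewrite subrK expr1n mulr1.
rewrite exprDn mulr_sumr; apply: eq_bigr => i _.
have iD : (i + a <= D)%N by have := ltn_ord i; lia.
rewrite /binratio mulrAC -natrM [X in X%:R]mulnC mul_bin_sub ?leq_addl //.
rewrite addnK natrM mulrAC mulfV // mul1r scaler_nat mulrnAr; congr (_ *+ _).
by rewrite addnC subnDA exprD; ring.
Qed.

(** Raising [a] by one multiplies the ratio by [(i - a) / (D - a)], which is within [a / D] of
    [i / D]. The errors add up, and [a ^ 2 + a <= (a + 1) ^ 2]. *)
Lemma binratio_approx (D i a : nat) : (i <= D)%N -> (a <= D)%N -> (0 < D)%N ->
  [/\ 0 <= binratio D i a <= 1, 0 <= (i%:R / D%:R : R) <= 1 &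
     `|binratio D i a - (i%:R / D%:R) ^+ a| <= (a ^ 2)%N%:R / D%:R].
Proof.
move=> iD aD D0; have D0' : 0 < D%:R :> R by rewrite ltr0n.
have z01 : 0 <= (i%:R / D%:R : R) <= 1.
  by rewrite divr_ge0 ?ler0n //= ler_pdivrMr // mul1r ler_nat.
split => //.
  rewrite divr_ge0 ?ler0n //= ler_pdivrMr ?ltr0n ?bin_gt0 // mul1r ler_nat.
  by rewrite leq_bin2l.
elim: a aD => [|a IH] aD.
  by rewrite /binratio !bin0 divr1 expr0 subrr normr0 mul0r.
have aD' := ltnW aD; have {IH} := IH aD'.
pose s : R := (i - a)%:R / (D - a)%:R; pose z : R := i%:R / D%:R.
have Da0 : 0 < (D - a)%:R :> R by rewrite ltr0n subn_gt0.
have rS : binratio D i a.+1 = binratio D i a * s.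
  rewrite /binratio /s.
  have C1 : 'C(D, a)%:R != 0 :> R by rewrite pnatr_eq0 -lt0n bin_gt0.
  have C2 : 'C(D, a.+1)%:R != 0 :> R by rewrite pnatr_eq0 -lt0n bin_gt0.
  have e k : (a.+1%:R * 'C(k, a.+1)%:R = (k - a)%:R * 'C(k, a)%:R :> R).
    by rewrite -!natrM mul_bin_left.
  have := e i; have := e D; have a0 : a.+1%:R != 0 :> R by rewrite pnatr_eq0.
  move=> eD ei; apply: (mulfI a0); rewrite mulrA ei.
  apply: (mulIf C2); rewrite mulfVK //.
  apply: (mulIf C1).
  have -> : a.+1%:R * ('C(i, a)%:R / 'C(D, a)%:R * ((i - a)%:R / (D - a)%:R)) *
     'C(D, a.+1)%:R * 'C(D, a)%:R =
     'C(i, a)%:R * (i - a)%:R * (a.+1%:R * 'C(D, a.+1)%:R) / (D - a)%:R :> R.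
     by field; rewrite C1 gt_eqF.
  by rewrite eD; field; rewrite gt_eqF.
have s01 : 0 <= s <= 1.
  by rewrite divr_ge0 ?ler0n //= ler_pdivrMr // mul1r ler_nat leq_sub2r.
have sz : `|s - z| <= a%:R / D%:R.
  rewrite ler_pdivlMr // -[X in _ * X]gtr0_norm // -normrM.
  have [ai|ia] := leqP a i.
    have -> : (s - z) * D%:R = - (a%:R * ((D - i)%:R / (D - a)%:R)).
      rewrite /s /z !natrB //; field; rewrite -natrB //.
      by rewrite !gt_eqF.
    rewrite normrN ger0_norm ?mulr_ge0 ?divr_ge0 ?ler0n //.
    rewrite ler_piMr ?ler0n // ler_pdivrMr // mul1r ler_nat leq_sub2l //.
  (* The truncated difference [i - a] is [0] here, so the gap is just [i / D], with [i < a]. *)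
  rewrite /s (eqP (ltnW ia)) mul0r sub0r mulNr divfK ?gt_eqF // normrN.
  by rewrite ger0_norm ?ler0n // ler_nat ltnW.
have r0 : 0 <= binratio D i a <= 1.
  rewrite divr_ge0 ?ler0n //= ler_pdivrMr ?ltr0n ?bin_gt0 // mul1r ler_nat.
  by rewrite leq_bin2l.
rewrite -/z rS => IH.
have -> : binratio D i a * s - z ^+ a.+1 =
  (binratio D i a - z ^+ a) * s + z ^+ a * (s - z) by rewrite exprSr; ring.
apply: le_trans (ler_normD _ _) _; rewrite (normrM _ s) (normrM _ (s - z)).
have le1 : `|binratio D i a - z ^+ a| * `|s| <= (a ^ 2)%N%:R / D%:R.
  apply: le_trans IH; rewrite ler_piMr //.
  by case/andP: s01 => s0 s1; rewrite ger0_norm.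
have le2 : `|z ^+ a| * `|s - z| <= a%:R / D%:R.
  apply: le_trans sz; rewrite ler_piMl //.
  case/andP: z01 => z0 z1; rewrite ger0_norm ?exprn_ge0 //.
  by rewrite exprn_ile1.
apply: le_trans (lerD le1 le2) _; rewrite -mulrDl ler_pM2r ?invr_gt0 //.
by rewrite -natrD ler_nat; nia.
Qed.

(** Telescoping: the factors are exchanged one at a time, and all the others have absolute value at
    most [1]. *)
Lemma distr_prod_le (T : finType) (u v : T -> R) :
  (forall t, 0 <= u t <= 1) -> (forall t, 0 <= v t <= 1) ->
  `|\prod_t u t - \prod_t v t| <= \sum_t `|u t - v t|.
Proof.
move=> u01 v01; elim: (index_enum T) => [|t r IH].
  by rewrite !big_nil subrr normr0.
rewrite !big_cons; set U := \prod_(_ <- _) _ in IH *; set V := \prod_(_ <- _) _ in IH *.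
have V01 : 0 <= V <= 1.
  rewrite /V prodr_ge0 => [/=|i _]; last by case/andP: (v01 i).
  by apply: prodr_ile1.
have -> : u t * U - v t * V = (u t - v t) * V + u t * (U - V) by ring.
apply: le_trans (ler_normD _ _) _; rewrite !normrM.
case/andP: V01 => V0 V1; case/andP: (u01 t) => u0 u1.
apply: lerD; first by rewrite ler_piMr // ger0_norm.
by apply: le_trans IH; rewrite ler_piMl // ger0_norm.
Qed.

(* The Bernstein coefficients of [U] of order [D] converge uniformly to the
   values of [U] on the grid of mesh [1 / D], hence are positive for large [D]. *)
Lemma kcone_bernstein (n m : nat) (g : 'I_m -> {mpoly R[n]}) (J : {set 'I_m})
    (U : {mpoly R[m]}) (e : R) :
  in_vars J U -> 0 < e ->
  (forall y : 'rV[R]_m, (forall j, 0 <= y ord0 j <= 1) -> e <= mev y U) ->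
  exists d, kcone g J d (U \mPo [tuple g j | j < m]).
Proof.
move=> UJ e0 Ue.
(* [S / D] will bound the error of every coefficient. Taking [D] above [S / e] brings it below [e];
   taking it above [msize U] makes degree elevation apply to all exponents of [U]. *)
pose S : R := \sum_(mo <- msupp U) `|U@_mo| * \sum_j ((mo j) ^ 2)%N%:R.
have S0 : 0 <= S.
  by rewrite sumr_ge0 // => mo _; rewrite mulr_ge0 // sumr_ge0.
pose D := (msize U + Num.bound (S / e)).+1.
have D0 : 0 < D%:R :> R by rewrite ltr0n.
have SD : S / D%:R <= e.
  rewrite ler_pdivrMr // mulrC -ler_pdivrMr //.
  apply: le_trans (ltW (archi_boundP _)) _; first by rewrite divr_ge0 // ltW.
  by rewrite ler_nat /D leqW // leq_addl.
have moD mo j : mo \in msupp U -> (mo j <= D)%N.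
  move=> /msize_mdeg_lt moU; rewrite /D ltnW // ltnS.
  rewrite (leq_trans _ (leq_addr _ _)) // (leq_trans _ (ltnW moU)) //.
  by rewrite mdegE (bigD1 j) //= leq_addr.
(* Each of the [m] variables contributes at most [f j + (D - f j) = D] to the total exponent. *)
exists (m * D)%N.
(* Only the variables in [J] are expanded. Outside [J] the exponents are [0], and the factor of
   [kap] retains the single index [f j = 0]. *)
pose A (f : {ffun 'I_m -> 'I_D.+1}) j := if j \in J then nat_of_ord (f j) else 0%N.
pose B (f : {ffun 'I_m -> 'I_D.+1}) j := if j \in J then (D - f j)%N else 0%N.
pose kap (f : {ffun 'I_m -> 'I_D.+1}) : R :=
  \prod_j (if j \in J then 'C(D, f j) else (f j == 0%N :> nat))%:R.
have monE mo : mo \in msupp U -> \prod_j tnth [tuple g j | j < m] j ^+ mo j =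
    \sum_(f : {ffun 'I_m -> 'I_D.+1})
      (\prod_j binratio D (f j) (mo j) * kap f) *: hab g (A f) (B f).
  move=> moU.
  pose E j (i : 'I_D.+1) : {mpoly R[n]} :=
    (binratio D i (mo j) * (if j \in J then 'C(D, i) else (i == 0%N :> nat))%:R) *:
    (g j ^+ (if j \in J then nat_of_ord i else 0%N) *
     (1 - g j) ^+ (if j \in J then (D - i)%N else 0%N)).
  transitivity (\prod_j \sum_(i < D.+1) E j i).
    apply: eq_bigr => j _; rewrite tnth_mktuple /E; case: (boolP (j \in J)) => jJ.
      exact/exprn_bernstein/moD.
    rewrite (UJ _ moU _ jJ) expr0 (bigD1 ord0) //= big1 ?addr0.
      by rewrite /binratio !bin0 divr1 mulr1 scale1r mulr1.
    move=> i i0; have -> : (i == 0%N :> nat) = false by exact: negbTE.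
    by rewrite mulr0 scale0r.
  rewrite bigA_distr_bigA /=; apply: eq_bigr => f _.
  by rewrite /E scaler_prod big_split.
rewrite comp_mpolyE (eq_big_seq (fun mo => \sum_(f : {ffun 'I_m -> 'I_D.+1})
  (U@_mo * \prod_j binratio D (f j) (mo j) * kap f) *: hab g (A f) (B f))); last first.
  move=> mo moU; rewrite monE // scaler_sumr; apply: eq_bigr => f _.
  by rewrite scalerA mulrA.
rewrite exchange_big /=; apply: kcone_sum => f _.
rewrite -scaler_suml -mulr_suml; apply: kconeZ; last first.
  apply: kcone_hab => [j /negPf jJ|]; first by rewrite /A /B jJ.
  have -> : (m * D = \sum_(j < m) D)%N by rewrite sum_nat_const card_ord.
  apply: leq_sum => j _.
  by rewrite /A /B; case: ifP => // _; rewrite subnKC // -ltnS.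
apply: mulr_ge0; last by apply: prodr_ge0 => j _; exact: ler0n.
(* The grid point attached to [f]: replacing each [binratio] by a power of [f j / D] turns the
   coefficient into the value of [U] at [y], which is at least [e >= S / D]. *)
pose y : 'rV[R]_m := \row_j ((f j)%:R / D%:R).
have fD j : (f j <= D)%N by rewrite -ltnS.
have y01 j : 0 <= y ord0 j <= 1.
  by rewrite mxE; case: (@binratio_approx D (f j) 0 (fD j) (leq0n _) isT).
have := le_trans SD (Ue y y01); rewrite mevE => h.
set c := \sum_(mo <- _) _ in h; set X := (X in 0 <= X).
suff : `|X - c| <= S / D%:R by rewrite ler_norml => /andP[h' _]; lra.
rewrite /X /c -sumrB /S mulr_suml.
apply: le_trans (ler_norm_sum _ _ _) _; rewrite 2!big_seq; apply: ler_sum => mo moU.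
rewrite -mulrBr -mulrA normrM ler_wpM2l // mulr_suml.
apply: le_trans (distr_prod_le _ _) _ => [j|j|].
- by case: (@binratio_approx D (f j) (mo j) (fD j) (moD _ _ moU) isT).
- by case/andP: (y01 j) => y0 y1; rewrite exprn_ge0 //= exprn_ile1.
apply: ler_sum => j _; rewrite mxE.
by case: (@binratio_approx D (f j) (mo j) (fD j) (moD _ _ moU) isT).
Qed.

End Bernstein.

(** * Uniform bounds on compact sets *)

Section Compactness.
Variables (R : realType) (T : topologicalType).
Implicit Types (X : set T) (u v : T -> R).

(* With the penalty [N] and the margin [1 / N] tied to one parameter, a single
   near-covering argument produces both. *)
Lemma compact_penalty X u v : compact X -> continuous u -> continuous v ->
  (forall x, 0 <= v x) -> (forall x, X x -> v x = 0 -> 0 < u x) ->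
  exists N d : R, [/\ 0 < N, 0 < d & forall x, X x -> d <= u x + N * v x].
Proof.
move=> /compact_near_coveringP cX cu cv v0 uv.
have [N _ /(_ N (leqnn N)) hN] : \forall N \near \oo, X `<=`
    (fun N x => N.+1%:R^-1 <= u x + N.+1%:R * v x) N.
  apply: cX => x Xx.
  have [vx|vx] := eqVneq (v x) 0.
    have ux := uv _ Xx vx; have ux2 : u x / 2 < u x by lra.
    have ux3 : 0 < u x / 2 by lra.
    near=> x' N => /=.
    have h1 : u x / 2 < u x'.
      near: x'; exact: (cu x _ (lt_nbhsr ux2)).
    have h2 : N.+1%:R^-1 < u x / 2.
      near: N; exact: (near_infty_natSinv_lt (PosNum ux3)).
    have h3 : 0 <= N.+1%:R * v x' by rewrite mulr_ge0.
    by rewrite -[leLHS]addr0 lerD // ltW // (lt_trans h2).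
  have vx0 : 0 < v x by rewrite lt_def vx v0.
  have vx2 : v x / 2 < v x by lra.
  have ux1 : u x - 1 < u x by lra.
  near=> x' N => /=.
  have h1 : v x / 2 < v x' by near: x'; exact: (cv x _ (lt_nbhsr vx2)).
  have h2 : u x - 1 < u x' by near: x'; exact: (cu x _ (lt_nbhsr ux1)).
  (* For such [N] the penalty is at least [2 + |u x|]: it offsets [u x' > u x - 1] and still leaves
     [1], which is at least [1 / (N + 1)]. *)
  have h3 : (2 + `|u x|) / (v x / 2) <= N.+1%:R.
    apply: (@le_trans _ _ N%:R); last by rewrite ler_nat.
    by near: N; exact: nbhs_infty_ger.
  have h4 : N.+1%:R^-1 <= 1 :> R by rewrite invf_le1 ?ltr0n // ler1n.
  have h5 : 2 + `|u x| <= N.+1%:R * v x'.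
    rewrite ler_pdivrMr in h3; last by lra.
    apply: le_trans h3 _; rewrite ler_wpM2l //; lra.
  have := ler_norm (- u x); rewrite normrN.
  move: h2 h4 h5; set a := _ * v x'; set b := _^-1; set c := `|u x|.
  by lra.
by exists N.+1%:R, N.+1%:R^-1; split; rewrite ?invr_gt0 ?ltr0n.
Unshelve. all: end_near. Qed.

Lemma compact_bound X u : compact X -> continuous u ->
  exists2 c : R, 0 < c & forall x, X x -> `|u x| <= c.
Proof.
move=> /compact_near_coveringP cX cu.
have [N _ /(_ N (leqnn N)) hN] : \forall N \near \oo, X `<=`
    (fun N x => `|u x| <= N.+1%:R) N.
  apply: cX => x Xx; near=> x' N => /=.
  have h1 : `|u x' - u x| < 1.
    near: x'; move/cvgrPdist_lt : (cu x) => /(_ 1 ltr01).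
    by apply: filterS => y; rewrite distrC.
  have h3 : 1 + `|u x| <= N.+1%:R.
    apply: (@le_trans _ _ N%:R); last by rewrite ler_nat.
    by near: N; exact: nbhs_infty_ger.
  have := ler_distD 0 (u x') (u x); rewrite !subr0.
  have := ler_normD (u x' - u x) (u x); rewrite subrK; lra.
by exists N.+1%:R => //; rewrite ltr0n.
Unshelve. all: end_near. Qed.

End Compactness.

(** * Polynomial approximation of absolute values and minima *)

Section LatticeApproximation.
Variables (R : realType) (n : nat) (W : {set 'I_n}) (X : set 'rV[R]_n).
Hypothesis cX : compact X.
Implicit Types p q r d : {mpoly R[n]}.

(** The classical iteration for the square root of [d ^+ 2], increasing to [|d|] wherever
    [|d| <= 1]. *)
Fixpoint abs_iter d (k : nat) : {mpoly R[n]} :=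
  if k is k'.+1 then
    let r := abs_iter d k' in r + 2^-1 *: (d ^+ 2 - r ^+ 2)
  else 0.

Lemma abs_iter_in_vars d k : in_vars W d -> in_vars W (abs_iter d k).
Proof.
move=> hd; elim: k => [|k IH] /=; first exact: in_vars0.
apply: in_varsD => //; apply: in_varsZ; apply: in_varsB; exact: in_varsXn.
Qed.

(** With [t = |d|], one step multiplies the gap [t - r] by [1 - (t + r) / 2 <= 1 - t / 2], and [(1 -
    t / 2) (1 + (k + 1) t / 2) <= 1 + k t / 2]. The last bound gives a rate uniform in [t], down to
    [t = 0]. *)
Lemma abs_iterP d k (x : 'rV[R]_n) : `|mev x d| <= 1 ->
  [/\ 0 <= mev x (abs_iter d k), mev x (abs_iter d k) <= `|mev x d| &
   (`|mev x d| - mev x (abs_iter d k)) * (1 + k%:R * `|mev x d| / 2) <= `|mev x d|].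
Proof.
have : 0 <= `|mev x d| by []; have : mev x d ^+ 2 = `|mev x d| ^+ 2.
  by rewrite real_normK ?num_real.
move: (`|mev x d| : R) => t dt t0 t1; elim: k => [|k [r0 rt IH]].
  by rewrite /= mev0; split => //; lra.
rewrite /= mevD mevZ mevB !mevXn dt; set r := mev x _ in r0 rt IH *.
have tr : 0 <= t - r by lra.
have e : t - (r + 2^-1 * (t ^+ 2 - r ^+ 2)) = (t - r) * (1 - (t + r) / 2) by field.
split.
- have : 0 <= t ^+ 2 - r ^+ 2 by rewrite subr_sqr mulr_ge0 //; lra.
  lra.
- rewrite -subr_ge0 e mulr_ge0 //; lra.
rewrite e; apply: le_trans IH; rewrite -[leLHS]mulrA ler_wpM2l //.
have k0 : 0 <= k%:R :> R := ler0n _ _.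
have kt : 0 <= k%:R * t by exact: mulr_ge0.
have ktt : 0 <= k%:R * t * t by exact: mulr_ge0.
have ktr : 0 <= k%:R * t * r by exact: mulr_ge0.
have tt : 0 <= t * t by exact: mulr_ge0.
have tr' : 0 <= t * r by exact: mulr_ge0.
rewrite -[k.+1%:R]natr1; lra.
Qed.

Lemma approx_abs d (e : R) : in_vars W d -> 0 < e ->
  exists2 r, in_vars W r & forall x, X x -> `|mev x r - `|mev x d| | <= e.
Proof.
move=> hd e0; have [c c0 hc] := compact_bound cX (@mev_continuous R n d).
have c0' : c != 0 by rewrite gt_eqF.
(* Rescaling makes [|d'| <= 1] on [X]. The third bound of [abs_iterP] then yields [k (t - r) <= 2],
   hence an error of at most [2 c / k <= e] after scaling back. *)
pose d' := c^-1 *: d; pose k := (Num.bound (2 * c / e)).+1.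
have ke : 2 * c / e <= k%:R.
  apply: le_trans (ltW (archi_boundP _)) _; last by rewrite ler_nat.
  by rewrite divr_ge0 ?mulr_ge0 // ltW.
exists (c *: abs_iter d' k) => [|x Xx].
  by apply: in_varsZ; apply: abs_iter_in_vars; exact: in_varsZ.
have d'1 : `|mev x d'| <= 1.
  by rewrite mevZ normrM gtr0_norm ?invr_gt0 // mulrC ler_pdivrMr // mul1r hc.
have dE : `|mev x d| = c * `|mev x d'|.
  by rewrite mevZ normrM gtr0_norm ?invr_gt0 // mulrA mulfV // mul1r.
have [r0 rt h] := abs_iterP k d'1.
rewrite mevZ dE -mulrBr normrM gtr0_norm // distrC ger0_norm ?subr_ge0 //.
move: r0 rt h; set t := `|mev x d'|; set r := mev x _ => r0 rt h.
have [t0|t0] := eqVneq t 0; first by rewrite (_ : t - r = 0) ?mulr0 ?ltW //; lra.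
have t0' : 0 < t by rewrite lt_def t0 normr_ge0.
have k0 : 0 < k%:R :> R by rewrite ltr0n.
have h2 : (t - r) * k%:R <= 2.
  rewrite -(ler_pM2r t0'); have : 0 <= t - r by lra.
  lra.
have h3 : 2 * c <= k%:R * e by rewrite -ler_pdivrMr.
have h4 : c * ((t - r) * k%:R) <= c * 2 by rewrite ler_wpM2l // ltW.
by rewrite -(ler_pM2r k0); lra.
Qed.

Lemma approx_min2 p q (e : R) : in_vars W p -> in_vars W q -> 0 < e ->
  exists2 r, in_vars W r & forall x, X x ->
    `|mev x r - Num.min (mev x p) (mev x q)| <= e.
Proof.
move=> hp hq e0; have [r hr rd] := approx_abs (in_varsB hp hq) e0.
exists (2^-1 *: (p + q - r)) => [|x Xx].
  by apply: in_varsZ; apply: in_varsB => //; exact: in_varsD.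
have := rd _ Xx; rewrite mevZ !mevB mevD minr_absE.
set P := mev x p; set Q := mev x q; set A := `|P - Q|; set S := mev x r.
have -> : 2^-1 * (P + Q - S) - (P + Q - A) / 2 = - ((S - A) / 2) by field.
by rewrite normrN normrM [ `|2^-1|]ger0_norm ?invr_ge0 // => h; have := normr_ge0 (S - A); lra.
Qed.

(** The two clauses together place [r] within [e] of the minimum over [s]. Half of [e] goes to the
    tail of the list and half to the last binary minimum. *)
Lemma approx_min (T : eqType) (s : seq T) (F : T -> {mpoly R[n]}) (e : R) :
  s != [::] -> (forall t, in_vars W (F t)) -> 0 < e ->
  exists2 r, in_vars W r & forall x, X x ->
    (forall t, t \in s -> mev x r <= mev x (F t) + e) /\
    (exists2 t, t \in s & mev x (F t) <= mev x r + e).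
Proof.
elim: s e => // t0 [_ e _ hF e0|t1 s IH e _ hF e0].
  exists (F t0) => // x _; split => [t|]; last first.
    by exists t0; rewrite ?mem_head // lerDl ltW.
  by rewrite inE => /eqP ->; rewrite lerDl ltW.
have e2 : 0 < e / 2 by lra.
have [r' hr' rP'] := IH _ isT hF e2.
have [r hr rP] := approx_min2 (hF t0) hr' e2.
exists r => // x Xx; have [h1 [t ts h2]] := rP' _ Xx; have := rP _ Xx.
rewrite ler_distl => /andP[l1 l2].
have m1 : Num.min (mev x (F t0)) (mev x r') <= mev x (F t0) by rewrite ge_min lexx.
have m2 : Num.min (mev x (F t0)) (mev x r') <= mev x r' by rewrite ge_min lexx orbT.
split.
  by move=> t'; rewrite inE => /orP[/eqP ->|/h1]; lra.
have [h|h] := leP (mev x (F t0)) (mev x r').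
  exists t0; first exact: mem_head.
  by rewrite (min_l h) in l1; lra.
exists t; first by rewrite inE ts orbT.
by rewrite (min_r (ltW h)) in l1; lra.
Qed.

End LatticeApproximation.

(** * Separation in shared variables and splitting along the running intersection property *)

Section Separation.
Variables (R : realType) (n : nat).
Implicit Types (I W : {set 'I_n}) (h F G : {mpoly R[n]}) (x y a b : 'rV[R]_n).

(* [h] approximates the inf-convolution [y |-> min_(a in A) (F a + N |a - y|_W ^ 2)],
   in which finitely many [a] suffice by compactness. *)
Lemma polynomial_separation (X A B : set 'rV[R]_n) W F G :
  compact X -> compact A -> compact B -> B `<=` X -> A `<=` X ->
  (forall a b, A a -> B b -> (forall i, i \in W -> a ord0 i = b ord0 i) ->
     0 < mev a F + mev b G) ->
  exists h, [/\ in_vars W h, forall a, A a -> mev a h < mev a F &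
    forall b, B b -> 0 < mev b G + mev b h].
Proof.
move=> cX cA cB BX AX FG.
(* For empty [A] only the inequality on [B] remains, and a constant exceeding the bound on [|G|]
   satisfies it. *)
have [A0|/set0P[a0 Aa0]] := eqVneq A set0.
  have [c c0 hc] := compact_bound cB (@mev_continuous R n G).
  exists (c + 1)%:MP; split; first exact: in_varsC.
    by move=> a; rewrite A0.
  by move=> b /hc; rewrite ler_norml mevC => /andP[h _]; lra.
pose q : {mpoly R[n]} := \sum_(i in W) 'X_i ^+ 2.
have qE x : mev x q = \sum_(i in W) x ord0 i ^+ 2.
  by rewrite mev_sum; apply: eq_bigr => i _; rewrite mevXn mevX.
pose u (z : 'rV[R]_n * 'rV[R]_n) : R := mev z.1 F + mev z.2 G.
pose v (z : 'rV[R]_n * 'rV[R]_n) : R := mev (z.1 - z.2) q.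
have cu : continuous u.
  move=> z; apply: cvgD.
    apply: (@continuous_comp _ _ _ fst (fun x => mev x F)); first exact: cvg_fst.
    exact: mev_continuous.
  apply: (@continuous_comp _ _ _ snd (fun x => mev x G)); first exact: cvg_snd.
  exact: mev_continuous.
have cv : continuous v.
  have cB' : continuous (fun z : 'rV[R]_n * 'rV[R]_n => z.1 - z.2 : 'rV[R]_n).
    by move=> z; apply: cvgB; [exact: cvg_fst|exact: cvg_snd].
  by move=> z; exact: (continuous_comp (cB' z) (@mev_continuous R n q _)).
have v0 z : 0 <= v z by rewrite /v qE sumr_ge0 // => i _; rewrite sqr_ge0.
have uv z : (A `*` B) z -> v z = 0 -> 0 < u z.
  case=> Az Bz vz; apply: FG => // i iW; apply/eqP; rewrite -subr_eq0 -sqrf_eq0.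
  move: vz; rewrite /v qE => /psumr_eq0P vz; have := vz _ i iW; rewrite !mxE => -> //.
  by move=> k _; rewrite sqr_ge0.
have [N [d [N0 d0 hN]]] := compact_penalty (compact_setX cA cB) cu cv v0 uv.
(* Three errors of size [e] must fit into the margin [d]. On [A], [r < F + 2 e], whence the shift by
   [2 e] in the final choice [r - 2 e]; on [B], [r >= d - G - e], so that [G + r - 2 e >= e]. *)
pose e := d / 4; have e0 : 0 < e by rewrite /e; lra.
pose ha (a : 'rV[R]_n) : {mpoly R[n]} :=
  (mev a F)%:MP + N *: \sum_(i in W) ('X_i - (a ord0 i)%:MP) ^+ 2.
have haE a b : mev b (ha a) = mev a F + N * v (a, b).
  rewrite mevD mevC mevZ mev_sum /v qE; congr (_ + _ * _); apply: eq_bigr => i _.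
  by rewrite mevXn mevB mevX mevC !mxE -sqrrN opprB.
have haW a : in_vars W (ha a).
  apply: in_varsD; first exact: in_varsC.
  apply: in_varsZ; apply: in_vars_sum => i iW; apply: in_varsXn.
  by apply: in_varsB; [exact: in_varsX|exact: in_varsC].
(* The paraboloid [ha a] meets [F] at [a], so it stays below [F + e] near [a]; finitely many of
   these neighbourhoods cover [A]. *)
move: (cA); rewrite compact_cover.
move=> /(_ _ A (fun a => (fun x => mev x (ha a - F)) @^-1` [set y | y < e])).
case=> [a _|a Aa|D DA AD].
- by apply: open_comp; [move=> x _; exact: mev_continuous|exact: open_lt].
- exists a => //=; rewrite mevB haE /v subrr qE big1 => [|i _]; first by lra.
  by rewrite mxE expr0n.
pose s : seq 'rV[R]_n := finmap.enum_fset D.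
have s0 : s != [::].
  by have [t tD _] := AD _ Aa0; apply: contraTneq tD => s0; rewrite /= -[_ \in _]/(t \in s) s0.
have [r rW rP] := approx_min cX s0 haW e0.
exists (r - (2 * e)%:MP); split.
- by apply: in_varsB => //; exact: in_varsC.
- move=> a Aa; have [t ts] := AD _ Aa; rewrite /= mevB => ht.
  have [/(_ t ts) h _] := rP a (AX _ Aa).
  by rewrite mevB mevC; lra.
- move=> b Bb; have [_ [t ts h]] := rP b (BX _ Bb).
  have At : A t by have := DA t ts; rewrite inE.
  have := hN (t, b) (conj At Bb); rewrite haE in h.
  rewrite /u /= mevB mevC /e in h *; lra.
Qed.

Definition glue I a b : 'rV[R]_n := \row_i (if i \in I then a ord0 i else b ord0 i).

(** Induction on the number of blocks, splitting off the last one. The variables it shares with the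
    others all lie in one earlier [I s], so a separating polynomial in them can be moved from the
    last block to block [s]. Closure of [X] under [glue] lets points that agree on the shared
    variables be merged. *)
Lemma running_intersection_decomposition (X : set 'rV[R]_n) (p : nat)
    (I : nat -> {set 'I_n}) (K : nat -> set 'rV[R]_n) (F : nat -> {mpoly R[n]}) :
  compact X -> (forall S a b, X a -> X b -> X (glue S a b)) ->
  (forall l, closed (K l)) ->
  (forall l x y, (forall i, i \in I l -> x ord0 i = y ord0 i) -> K l x -> K l y) ->
  (forall q, (0 < q < p)%N -> exists2 s, (s < q)%N &
     forall i, i \in I q -> (exists2 r, (r < q)%N & i \in I r) -> i \in I s) ->
  (forall l, (l < p)%N -> in_vars (I l) (F l)) ->
  (forall x, X x -> (forall l, (l < p)%N -> K l x) -> 0 < \sum_(l < p) mev x (F l)) ->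
  exists F' : nat -> {mpoly R[n]},
    [/\ forall l, (l < p)%N -> in_vars (I l) (F' l),
        \sum_(l < p) F' l = \sum_(l < p) F l &
        forall l, (l < p)%N -> forall x, X x -> K l x -> 0 < mev x (F' l)].
Proof.
move=> cX Xglue clK Kext; elim: p F => [|q IH] F rip FI Fpos.
  by exists F; split.
(* A single block already carries the whole positive sum. *)
have [q0|q0] := posnP q.
  exists F; split => // l; rewrite q0 ltnS leqn0 => /eqP -> x Xx Kx.
  have := Fpos x Xx; rewrite q0 big_ord_recl big_ord0 addr0; apply.
  by move=> l'; rewrite ltnS leqn0 => /eqP ->.
have [|s sq sP] := rip q; first by rewrite q0 ltnSn.
pose W := [set i in I q | [exists r : 'I_q, i \in I r]].
have Wq : W \subset I q by apply/fintype.subsetP => i; rewrite inE => /andP[].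
have Ws : W \subset I s.
  apply/fintype.subsetP => i; rewrite inE => /andP[iq /existsP[r ir]].
  by apply: sP => //; exists r.
pose A := X `&` K q.
pose B := X `&` \bigcap_(l in [set l | (l < q)%N]) K l.
have cA : compact A by exact: compact_closedI.
have cB : compact B by apply: compact_closedI => //; apply: closed_bigI => l _.
have [|h [hW hA hB]] := @polynomial_separation X A B W (F q) (\sum_(l < q) F l)
    cX cA cB (@subIsetl _ _ _) (@subIsetl _ _ _).
  (* Agreement on [W] makes [x] coincide with [a] on [I q] and with [b] on every earlier [I l].
     Hence [x] meets all constraints, and the positive total at [x] is the sum of the two sides. *)
  move=> a b [Xa Ka] [Xb Kb] ab; pose x := glue (I q) a b.
  have xa i : i \in I q -> a ord0 i = x ord0 i by rewrite mxE => ->.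
  have xb l i : (l < q)%N -> i \in I l -> b ord0 i = x ord0 i.
    move=> lq il; rewrite mxE; case: ifPn => // iq; rewrite ab // inE iq.
    by apply/existsP; exists (Ordinal lq).
  rewrite mev_sum addrC (mev_in_vars (FI q _) xa) //.
  rewrite (eq_bigr (fun l : 'I_q => mev x (F l))) => [|l _]; last first.
    by apply: (mev_in_vars (FI l (ltnW (ltn_ord l)))) => i; exact: xb.
  have := Fpos x (Xglue _ _ _ Xa Xb); rewrite big_ord_recr; apply => l.
  rewrite ltnS leq_eqVlt => /orP[/eqP ->|lq]; first exact: Kext xa Ka.
  by apply: Kext (Kb l lq) => i; exact: xb.
pose F1 l := F l + (if l == s then h else 0).
have F1sum : \sum_(l < q) F1 l = \sum_(l < q) F l + h.
  by rewrite big_split -big_mkcond (big_pred1 (Ordinal sq)).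
have [|l lq|x Xx Kx|F' [F'I F'sum F'pos]] := IH F1.
- move=> q' /andP[q'0 q'q]; apply: rip; rewrite q'0; exact: ltnW.
- apply: in_varsD; first by apply: FI; exact: ltnW.
  by case: eqP => [->|_]; [exact: in_varsS hW|exact: in_vars0].
- by rewrite -mev_sum F1sum mevD; apply: hB.
exists (fun l => if l == q then F q - h else F' l); split.
- move=> l; rewrite ltnS leq_eqVlt; case: eqP => [-> _|_ /= lq]; last exact: F'I.
  by apply: in_varsB; [exact: FI|exact: in_varsS hW].
- rewrite !big_ord_recr /= eqxx (eq_bigr (fun l : 'I_q => F' l)) => [|l _].
    by rewrite F'sum F1sum; ring.
  by rewrite ltn_eqF.
- move=> l; rewrite ltnS leq_eqVlt; case: eqP => [-> _|_ /= lq] x Xx Kx; last exact: F'pos.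
  by rewrite mevB subr_gt0; apply: hA.
Qed.

End Separation.

(** * Membership of positive block polynomials in the cone *)

(* [x |-> (g_j x)_j] identifies R^I with a real algebraic set [V = 0] of R^J, and
   a penalty [N V] makes [f], seen as a polynomial in the [g_j], positive on the
   whole cube without changing it on that set. *)
Lemma kcone_positivstellensatz (R : realType) (n m : nat) (g : 'I_m -> {mpoly R[n]})
    (I : {set 'I_n}) (J : {set 'I_m}) (f : {mpoly R[n]}) :
  generates g I J -> (forall j, j \in J -> in_vars I (g j)) -> in_vars I f ->
  (forall x : 'rV[R]_n, Kloc g I J x -> 0 < mev x f) ->
  exists d, kcone g J d f.
Proof.
move=> gen gI fI fpos; set G := [tuple g j | j < m].
have [P [PJ fP]] := gen f fI.
(* [Y i] expresses [X_i] through the generators; the value [0] off [I] puts the point built from [Y]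
   into the copy of [R^I] used by [Kloc]. *)
have [i|Y YP] := @choice _ _ (fun i (Q : {mpoly R[m]}) =>
    [/\ in_vars J Q, i \in I -> Q \mPo G = 'X_i & i \notin I -> Q = 0]).
  have [iI|iI] := boolP (i \in I).
    by have [Q [QJ QE]] := gen 'X_i (in_varsX iI); exists Q; split => //; rewrite iI.
  by exists 0; split => //; exact: in_vars0.
pose Yt := [tuple Y i | i < n].
(* Equations of the image: where all [Q j] with [j \in J] vanish, [y] agrees on [J] with the values
   of the [g j] at the point with coordinates [Y i (y)]. *)
pose Q j : {mpoly R[m]} := 'X_j - (g j \mPo Yt).
have QJ j : j \in J -> in_vars J (Q j).
  move=> jJ; apply: in_varsB; first exact: in_varsX.
  by apply: in_vars_comp => i; rewrite tnth_mktuple; case: (YP i).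
have QG j : j \in J -> Q j \mPo G = 0.
  move=> jJ; rewrite comp_mpolyB comp_mpolyXU -tnth_nth tnth_mktuple comp_mpolyA.
  rewrite (comp_mpoly_in_vars (lq' := [tuple 'X_i | i < n]) (gI _ jJ)).
    by rewrite comp_mpoly_id subrr.
  by move=> i iI; rewrite !tnth_mktuple; case: (YP i) => _ ->.
pose V := \sum_(j in J) Q j ^+ 2.
have VE y : mev y V = \sum_(j in J) mev y (Q j) ^+ 2.
  by rewrite mev_sum; apply: eq_bigr => j _; rewrite mevXn.
pose C := [set y : 'rV[R]_m | forall j, `[0, 1]%classic (y ord0 j)].
have cC : compact C.
  exact: (@rV_compact R m (fun=> `[0, 1]%classic) (fun=> @segment_compact R 0 1)).
have V0 y : 0 <= mev y V by rewrite VE sumr_ge0 // => j _; rewrite sqr_ge0.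
have PV y : C y -> mev y V = 0 -> 0 < mev y P.
  move=> Cy; rewrite VE => /psumr_eq0P Vy.
  pose x : 'rV[R]_n := \row_i mev y (Y i).
  have gx j : j \in J -> mev x (g j) = y ord0 j.
    move=> jJ; have /eqP : mev y (Q j) ^+ 2 = 0.
      by apply: Vy => // k _; rewrite sqr_ge0.
    rewrite sqrf_eq0 mevB mevX subr_eq0 => /eqP ->.
    rewrite /mev comp_mpoly_meval; apply: meval_eq => i.
    by rewrite mxE tnth_mktuple.
  have <- : mev x f = mev y P.
    transitivity (mev (\row_j mev x (g j)) P).
      rewrite fP /mev comp_mpoly_meval; apply: meval_eq => j.
      by rewrite mxE tnth_mktuple.
    by apply: (mev_in_vars PJ) => j jJ; rewrite mxE gx.
  apply: fpos; split => [i iI|j jJ].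
    by rewrite mxE; case: (YP i) => _ _ ->; rewrite ?mev0.
  by rewrite gx //; have := Cy j; rewrite /= in_itv.
have [N [d [N0 d0 hN]]] := compact_penalty cC (@mev_continuous R m P)
  (@mev_continuous R m V) V0 PV.
have [||D kD] := @kcone_bernstein R n m g J (P + N *: V) d _ d0.
- apply: in_varsD => //; apply: in_varsZ; apply: in_vars_sum => j jJ.
  by apply: in_varsXn; exact: QJ.
- move=> y y01; rewrite mevD mevZ; apply: hN => j /=.
  by rewrite in_itv; exact: y01.
(* The penalty disappears once the generators are substituted, leaving [f] itself. *)
have VG : V \mPo G = 0.
  rewrite [LHS](raddf_sum (comp_mpoly G)) big1 // => j jJ.
  by rewrite /= rmorphXn /= QG // expr0n.
by exists D; move: kD; rewrite comp_mpolyD comp_mpolyZ -fP VG scaler0 addr0.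
Qed.

(** * Feasible values: monotonicity in [d] and the upper bound *)

Section Feasibility.
Variables (R : realType) (n m p : nat) (f : {mpoly R[n]}) (g : 'I_m -> {mpoly R[n]})
  (I : 'I_p -> {set 'I_n}) (J : 'I_p -> {set 'I_m}) (k : nat).
Implicit Types (d : nat) (t : R).

(** Naming the sum of squares [s l] hides the multipliers inside [kcone]; conversely, choice
    collects the multipliers of all blocks. *)
Lemma qfeasP d t : qfeas f g I J k d t <->
  exists fl s : 'I_p -> {mpoly R[n]}, f - t%:MP = \sum_(l < p) fl l /\
    forall l, [/\ poly_in (I l) (dmax f g k d) (fl l), sos_in (I l) k (s l) &
      kcone g (J l) d (fl l - s l)].
Proof.
split.
  case=> fl [lam [fE H]]; eexists fl, _; split; first exact: fE.
  move=> l; case: (H l) => hp hl hs; split; [exact: hp|exact: hs|].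
  by exists (lam l); split => //; rewrite subKr.
case=> fl [s [fE H]].
have [l|lam lamP] := @choice _ _ (fun (l : 'I_p) lam =>
    (forall a b, inN (J l) a b -> 0 <= lam a b) /\
    fl l - s l = \sum_(a : {ffun 'I_m -> 'I_d.+1})
          \sum_(b : {ffun 'I_m -> 'I_d.+1} | inN (J l) a b)
            lam a b *: hab g (fun j => nat_of_ord (a j)) (fun j => nat_of_ord (b j))).
  by case: (H l).
exists fl, lam; split => // l; case: (H l) (lamP l) => hp hs _ [lp lE].
by split => //; rewrite -lE subKr.
Qed.

Lemma qfeas_mono d1 d2 t : (d1 <= d2)%N ->
  qfeas f g I J k d1 t -> qfeas f g I J k d2 t.
Proof.
move=> dd /qfeasP[fl [s [fE H]]]; apply/qfeasP; exists fl, s; split => // l.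
case: (H l) => -[fI fs] hs hk; split => //; last exact: kcone_mono hk.
split => //; apply: leq_trans fs _; rewrite ltnS /dmax !geq_max leq_maxl /=.
by rewrite !leq_max leqnn /= leq_mul2r dd !orbT.
Qed.

(** Weak duality: on [K] both the cone elements and the sums of squares are nonnegative. *)
Lemma qfeas_le d t x : qfeas f g I J k d t -> Kset g x -> t <= mev x f.
Proof.
move=> /qfeasP[fl [s [fE H]]] xK.
rewrite -subr_ge0 -[X in _ - X](mevC x t) -mevB fE mev_sum sumr_ge0 // => l _.
case: (H l) => _ [r [_ sE]] hk; rewrite -(subrK (s l) (fl l)) mevD addr_ge0 //.
  by apply: kcone_ge0 hk => j _; exact: xK.
by rewrite sE mev_sum sumr_ge0 // => h _; rewrite mevXn sqr_ge0.
Qed.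

End Feasibility.

(** * Feasibility of every value below the minimum, and convergence *)

Lemma closed_mev_unit (R : realType) (n m : nat) (g : 'I_m -> {mpoly R[n]})
    (J : {set 'I_m}) :
  closed [set x : 'rV[R]_n | forall j, j \in J -> 0 <= mev x (g j) <= 1].
Proof.
rewrite (_ : [set x | _] =
  \bigcap_(j in [set j | j \in J]) ((fun x => mev x (g j)) @^-1` `[0, 1]%classic)).
  apply: closed_bigI => j _; apply: closed_comp; last exact: interval_closed.
  by move=> x _; exact: mev_continuous.
by apply/seteqP; split => x /= h j /h /=; rewrite in_itv.
Qed.

Lemma ball_constraint_bound (R : realType) (n : nat) (I : {set 'I_n}) (M : R)
    (x : 'rV[R]_n) (i : 'I_n) : 0 < M -> i \in I ->
  0 <= mev x (1 - M^-1 *: \sum_(i in I) 'X_i ^+ 2) -> x ord0 i ^+ 2 <= M.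
Proof.
move=> M0 iI; rewrite mevB mev1 mevZ subr_ge0 mulrC ler_pdivrMr // mul1r.
apply: le_trans; rewrite mev_sum (bigD1 i) //= mevXn mevX lerDl sumr_ge0 // => k _.
by rewrite mevXn sqr_ge0.
Qed.

Lemma ereal_lt_between (R : realType) (x y : \bar R) : (x < y)%E ->
  exists t : R, (x < t%:E < y)%E.
Proof.
case: x y => [r||] [s||] //; rewrite ?lte_fin => xy.
- by exists ((r + s) / 2); rewrite !lte_fin; apply/andP; split; lra.
- by exists (r + 1); rewrite lte_fin ltrDl ltr01 ltry.
- by exists (s - 1); rewrite ltNyr lte_fin gtrBl ltr01.
- by exists 0; rewrite ltNyr ltry.
Qed.

Lemma qfeas_below (R : realType) (n m p : nat) (f : {mpoly R[n]})
    (g : 'I_m -> {mpoly R[n]}) (I : 'I_p -> {set 'I_n}) (J : 'I_p -> {set 'I_m})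
    (k : nat) (t : R) :
  (0 < p)%N -> sparsity f g I J -> compact_gen g I J ->
  (forall x, Kset g x -> t < mev x f) -> exists d, qfeas f g I J k d t.
Proof.
case: p I J => // p I J _ [[fl [fE flI]] gI _ Jcover rip] cg tf.
have [l|M MP] := @choice _ _ (fun (l : 'I_p.+1) (M : R) => 0 < M /\
    exists2 j : 'I_m, j \in J l & g j = 1 - M^-1 *: \sum_(i in I l) 'X_i ^+ 2).
  by case: (cg l).
(* From [M l <= c] and [c >= 1] follows [M l <= c ^+ 2], so the ball constraint of each block forces
   [|x_i| <= c] on its variables. The box [X] thus contains every [Kloc]. *)
pose c := 1 + \sum_l M l.
have c1 : 1 <= c by rewrite lerDl sumr_ge0 // => l _; case: (MP l) => /ltW.
have Mc l : M l <= c ^+ 2.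
  have : M l <= c.
    rewrite /c (bigD1 l) //= addrCA lerDl addr_ge0 // sumr_ge0 // => l' _.
    by case: (MP l') => /ltW.
  by move=> /le_trans; apply; rewrite expr2 ler_peMr // (le_trans _ c1).
pose X := [set x : 'rV[R]_n | forall i, `[- c, c]%classic (x ord0 i)].
have cX : compact X.
  exact: (@rV_compact R n (fun=> `[- c, c]%classic) (fun=> @segment_compact R _ _)).
pose I' l := I (inord l).
(* Cylinders: unlike in [Kloc], the coordinates outside [I l] stay free, so that blocks can be
   imposed simultaneously on one point. *)
pose K l := [set x : 'rV[R]_n | forall j, j \in J (inord l) -> 0 <= mev x (g j) <= 1].
(* The constant [t] is charged to block [0] alone. *)
pose F l := fl (inord l) - (if l == 0%N then t else 0)%:MP.
have FE : \sum_(l < p.+1) F l = f - t%:MP.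
  rewrite /F sumrB fE; congr (_ - _).
    by apply: eq_bigr => l _; rewrite inord_val.
  rewrite (bigD1 ord0) //= big1 ?addr0 // => l /negbTE l0.
  by have -> : (l == 0%N :> nat) = false by exact: l0.
have FI l : in_vars (I' l) (F l) by apply: in_varsB; [exact: flI|exact: in_varsC].
have [||||||F' [F'I F'sum F'pos]] := @running_intersection_decomposition
    R n X p.+1 I' K F cX.
- by move=> S a b Xa Xb i; rewrite mxE; case: ifP => _; [exact: Xa|exact: Xb].
- by move=> l; exact: closed_mev_unit.
- move=> l x y xy Kx j jJ; rewrite -(mev_in_vars (gI _ _ jJ) xy); exact: Kx.
(* [rip] is indexed by the predecessor: [q] plays [l'] and [q.-1] plays [l], so [r <= l] means
   [r < q]. *)
- move=> q /andP[q0 qp].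
  have qE : (inord q : 'I_p.+1) = q :> nat by rewrite inordK.
  have q1E : (inord q.-1 : 'I_p.+1) = q.-1 :> nat by rewrite inordK // (leq_ltn_trans (leq_pred q)).
  have [|s [sq sP]] := rip (inord q.-1) (inord q); first by rewrite /= qE q1E prednK.
  exists s; first by rewrite q1E in sq; rewrite -(prednK q0) ltnS.
  move=> i iq [r rq ir]; rewrite /I' inord_val; apply: sP => //.
  exists (inord r); split => //; rewrite q1E inordK ?(ltn_trans rq) //.
  by rewrite -ltnS prednK.
- by move=> l _; exact: FI.
- move=> x Xx Kx; rewrite -mev_sum FE mevB mevC subr_gt0; apply: tf => j.
  by have [l jl] := Jcover j; apply: (Kx l) => //; rewrite inord_val.
have [l|d dP] := @choice _ _ (fun (l : 'I_p.+1) d => kcone g (J l) d (F' l)).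
  have [_ gen [_ _]] := cg l.
  apply: (kcone_positivstellensatz gen (gI l)).
    by have := F'I l (ltn_ord l); rewrite /I' inord_val.
  move=> x [x0 xK]; apply: F'pos => // [i|]; last by rewrite /K /= inord_val.
  rewrite /= in_itv /= -ler_norml.
  have [iI|iI] := boolP (i \in I l); last by rewrite x0 // normr0 (le_trans _ c1).
  have [M0 [j jJ gE]] := MP l.
  rewrite -(@ler_pXn2r _ 2) ?nnegrE ?(le_trans _ c1) // real_normK ?num_real //.
  apply: le_trans (Mc l); apply: (ball_constraint_bound M0 iI).
  by rewrite -gE; case/andP: (xK j jJ).
(* One order serves all blocks because the cones grow with [d]; the sums of squares are [0], written
   as the empty sum. *)
exists (\max_l d l); apply/qfeasP; exists (fun l => F' l), (fun=> 0); split.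
  by rewrite F'sum.
move=> l; have kl : kcone g (J l) (\max_l d l) (F' l).
  by apply: kcone_mono (dP l); exact: leq_bigmax.
split; last by rewrite subr0.
  split; first by have := F'I l (ltn_ord l); rewrite /I' inord_val.
  apply: leq_trans (kcone_msize kl) _; rewrite ltnS /dmax.
  by rewrite !leq_max leqnn !orbT.
by exists [::]; split => //; rewrite big_nil.
Qed.

Theorem mainTheorem3 (R : realType) (n m p : nat)
  (f : {mpoly R[n]}) (g : 'I_m -> {mpoly R[n]})
  (I : 'I_p -> {set 'I_n}) (J : 'I_p -> {set 'I_m}) (k : nat) :
  sparsity f g I J ->
  compact_gen g I J ->
  (forall d1 d2 : nat, (d1 <= d2)%N -> (qkd f g I J k d1 <= qkd f g I J k d2)%E) /\
  (qkd f g I J k d @[d --> \oo] --> fstar f g).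
Proof.
move=> sp cg.
have mono d1 d2 : (d1 <= d2)%N -> (qkd f g I J k d1 <= qkd f g I J k d2)%E.
  move=> dd; apply: ub_ereal_sup => _ [t ft <-]; apply: ereal_sup_ubound.
  by exists t => //; exact: qfeas_mono ft.
(* A non-decreasing sequence of extended reals tends to its supremum, so only the value of the
   supremum is left. *)
split => //; have := ereal_nondecreasing_cvgn mono.
suff -> : ereal_sup (range (qkd f g I J k)) = fstar f g by [].
have feas_le d t : qfeas f g I J k d t -> (t%:E <= ereal_sup (range (qkd f g I J k)))%E.
  move=> ft; apply: (@le_trans _ _ (qkd f g I J k d)).
    by apply: ereal_sup_ubound; exists t.
  by apply: ereal_sup_ubound; exists d.
apply/eqP; rewrite eq_le; apply/andP; split.
  apply: ub_ereal_sup => _ [d _ <-]; apply: ub_ereal_sup => _ [t ft <-].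
  apply: le_ereal_inf_tmp => _ [x xK <-]; rewrite lee_fin; exact: qfeas_le ft xK.
have [p0|p0] := posnP p.
  (* Without blocks, no [t <> 0] is feasible, but then [f = 0], and every point
     lies in [K] since there is no constraint either. *)
  case: sp => -[fl [fE _]] _ _ Jcover _.
  have no_block (l : 'I_p) : False by case: l => l; rewrite p0.
  have f0 : f = 0 by rewrite fE; apply: big1 => l; case: (no_block l).
  apply: (@le_trans _ _ 0%:E).
    apply: ereal_inf_lbound; exists 0; last by rewrite f0 mev0.
    by move=> j; have [l] := Jcover j; case: (no_block l).
  apply: (@feas_le 0%N); exists fl, (fun _ _ _ => 0); split.
    by rewrite mpolyC0 subr0.
  by move=> l; case: (no_block l).
(* Real [t] below [fstar] suffice, which also covers an empty [K], where [fstar] is [+oo]. *)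
have key (t : R) : (t%:E < fstar f g)%E -> (t%:E <= ereal_sup (range (qkd f g I J k)))%E.
  move=> tf; have [x xK|d] := @qfeas_below R n m p f g I J k t p0 sp cg.
    by rewrite -lte_fin (lt_le_trans tf) //; apply: ereal_inf_lbound; exists x.
  exact: feas_le.
rewrite leNgt; apply/negP => lt.
have [t /andP[lt1 lt2]] : exists t : R, (ereal_sup (range (qkd f g I J k)) < t%:E < fstar f g)%E.
  exact: ereal_lt_between.
by have := key t lt2; rewrite leNgt lt1.
Qed.
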